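(* Let $n,k,N\in\mathbb N$, let $\Omega\subset\mathbb R^n$ be a bounded open set, let $p\in[1,\infty)$ be fixed, and let $$\mathrm H:\ \Omega\times\mathbb R^N\times\mathbb R^{Nn}\times\cdots\times\mathbb R^{Nn^k}_s\longrightarrow\mathbb R$$ be a given continuous function. Let $$\mathrm C_{\infty,p}(u):=\frac{\mathrm E_\infty(u)}{\mathrm E_p(u)},\qquad u\in W^{k,\infty}(\Omega;\mathbb R^N),\ \mathrm E_1(u)\ne0,$$ where $\mathrm E_q(u):=\big\|\mathrm H(\cdot,u,\mathrm Du,\ldots,\mathrm D^ku)\big\|_{L^q(\Omega)}$ for $q\in[1,\infty]$, with rescaled (averaged) $L^q$-norms when $q<\infty$. Fix $\varphi\in W^{k,\infty}(\Omega;\mathbb R^N)$. For $\Lambda\ge 0$ consider the Dirichlet problem $$(\mathrm P_\Lambda)\qquad\big|\mathrm H(\cdot,u,\mathrm Du,\ldots,\mathrm D^ku)\big|=\Lambda\ \text{ a.e. in }\Omega,\qquad\mathrm D^ju=\mathrm D^j\varphi\ \text{ on }\partial\Omega\ \text{ for }j=0,\ldots,k-1 .$$ Suppose that there is some $\Lambda_*>0$ such that, for all $\Lambda\ge\Lambda_*$, the problem $(\mathrm P_\Lambda)$ is solvable, i.e. has a strong solution $u\in W^{k,\infty}_\varphi(\Omega;\mathbb R^N)$. Then, for any $u_\infty\in W^{k,\infty}_\varphi(\Omega;\mathbb R^N)$, the following statements are equivalent: (1) $u_\infty$ is a minimiser of $\mathrm C_{\infty,p}$ in the admissible class, namely $\mathrm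 E_1(u_\infty)\ne0$ and $$\mathrm C_{\infty,p}(u_\infty)=\inf\Big\{\mathrm C_{\infty,p}(u)\ :\ u\in W^{k,\infty}_\varphi(\Omega;\mathbb R^N),\ \mathrm E_1(u)\ne0\Big\}.$$ (2) There exists $\Lambda>0$ such that $u_\infty$ is a strong a.e. solution to the Dirichlet problem $(\mathrm P_\Lambda)$.
   Context: $\mathbb R^{Nn^j}_s$ denotes the space of tensors $\mathbf X\in\mathbb R^N\otimes(\mathbb R^n)^{\otimes j}$, with components $\mathbf X_{\alpha i_1\cdots i_j}$, which are symmetric under all permutations of the indices $(i_1,\ldots,i_j)$. For $u:\Omega\to\mathbb R^N$, $\mathrm D^ju$ is the tensor of (weak) $j$-th order derivatives, valued in $\mathbb R^{Nn^j}_s$. The rescaled $L^q$-norm for $1\le q<\infty$ is $\|f\|_{L^q(\Omega)}:=\big(\frac1{\mathcal L^n(\Omega)}\int_\Omega|f|^q\,d\mathcal L^n\big)^{1/q}$, where $\mathcal L^n$ is Lebesgue measure, and $\|f\|_{L^\infty(\Omega)}$ is the essential supremum of $|f|$ over $\Omega$. $W^{k,\infty}(\Omega;\mathbb R^N)$ is the usual Sobolev space, $W^{k,\infty}_0(\Omega;\mathbb R^N)$ is its subspace of zero-trace maps (traces of all derivatives of order $0,\ldots,k-1$ vanish, i.e. $W^{k,\infty}\cap W^{k,1}_0$), and $W^{k,\infty}_\varphi(\Omega;\mathbb R^N):=\varphi+W^{k,\infty}_0(\Omega;\mathbb R^N)$. The boundary condition ''$\mathrm D^ju=\mathrm D^j\varphi$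 on $\partial\Omega$ for $j=0,\ldots,k-1$'' means $u\in W^{k,\infty}_\varphi(\Omega;\mathbb R^N)$. A strong (a.e.) solution is one for which the PDE holds a.e. in $\Omega$ for the weak derivatives of $u$. *)

(* Defs.v *)
From HB Require Import structures.
From mathcomp Require Import all_boot all_order all_algebra.
From mathcomp Require Import all_classical all_reals all_analysis.
From mathcomp Require Import ess_sup_inf.

Set Implicit Arguments.
Unset Strict Implicit.
Unset Printing Implicit Defensive.

Import Order.TTheory GRing.Theory Num.Theory.
Import numFieldNormedType.Exports.

Local Open Scope classical_set_scope.
Local Open Scope ring_scope.

Definition measure_rV_display : measure_display.
Proof. exact: default_measure_display. Qed.

(* The product sigma-algebra on ['rV[R]_n], as the library does for tuples; it
   is the Borel sigma-algebra. *)
Section measurable_rV.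
Context {R : realType} (n : nat).

Let coors : 'I_n -> 'rV[R]_n -> measurableTypeR R := fun i v => v ord0 i.

Let rV_set0 : g_sigma_preimage coors set0.
Proof. exact: sigma_algebra0. Qed.

Let rV_setC A : g_sigma_preimage coors A -> g_sigma_preimage coors (~` A).
Proof. exact: sigma_algebraC. Qed.

Let rV_bigcup (F : _^nat) : (forall i, g_sigma_preimage coors (F i)) ->
  g_sigma_preimage coors (\bigcup_i (F i)).
Proof. exact: sigma_algebra_bigcup. Qed.

HB.instance Definition _ := @isMeasurable.Build measure_rV_display
  'rV[R]_n (g_sigma_preimage coors) rV_set0 rV_setC rV_bigcup.

Lemma measurable_coord (i : 'I_n) :
  measurable_fun setT (fun v : 'rV[R]_n => v ord0 i : measurableTypeR R).
Proof.
move=> _ Y mY; rewrite setTI; apply: sub_sigma_algebra => /=.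
rewrite -bigcup_seq/=; exists i => /=; first by rewrite mem_index_enum.
by exists Y => //; rewrite setTI.
Qed.

Lemma measurable_fun_rVP d (T : measurableType d) (f : T -> 'rV[R]_n) :
  measurable_fun setT f <->
  forall i, measurable_fun setT (fun x => f x ord0 i : measurableTypeR R).
Proof.
split=> [mf i|mf].
  exact: (measurableT_comp (measurable_coord i)).
apply: (@measurability _ _ _ _ _ _ (\big[setU/set0]_(i < n) preimage_set_system setT (coors i) measurable)) => //.
move=> _ [B + <-]; rewrite -bigcup_seq => -[i _ [C mC <-]].
rewrite !setTI -comp_preimage.
by rewrite -[X in measurable X]setTI; exact: mf.
Qed.

End measurable_rV.

(* Lebesgue measure on ['rV[R]_n] is the n-fold product of the one-dimensional
   one; see [lebesgue_rV_box] for its value on boxes. *)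
Section lebesgue_rV.
Context {R : realType}.

Definition consrV n (p : measurableTypeR R * 'rV[R]_n) : 'rV[R]_n.+1 :=
  row_mx p.1%:M p.2.

Fixpoint lebesgue_rV n : set 'rV[R]_n -> \bar R :=
  if n is m.+1 then
    pushforward (@lebesgue_measure R \x @lebesgue_rV m)%E (@consrV m)
  else @dirac _ _ (0 : 'rV[R]_0) R.

Lemma measurable_consrV n : measurable_fun setT (@consrV n).
Proof.
apply/measurable_fun_rVP => i; rewrite /consrV.
rewrite -[n.+1]/(1 + n)%N in i *.
case: (splitP i) => j ij.
  rewrite (_ : (fun _ => _) = fst) //; apply/funext => p.
  have -> : i = lshift n j by exact/val_inj.
  by rewrite row_mxEl mxE (ord1 j) eqxx.
rewrite (_ : (fun _ => _) = (fun v : 'rV[R]_n => v ord0 j) \o snd).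
  by apply: measurableT_comp => //; exact: measurable_coord.
apply/funext => p.
have -> : i = rshift 1 j by exact/val_inj.
by rewrite row_mxEr.
Qed.

Definition unconsrV n (v : 'rV[R]_n.+1) : measurableTypeR R * 'rV[R]_n :=
  (v ord0 ord0, \row_j v ord0 (lift ord0 j)).

Lemma consrVK n : cancel (@consrV n) (@unconsrV n).
Proof.
case=> t v; rewrite /unconsrV /consrV /=; congr (_, _).
  have -> : ord0 = lshift n (@ord0 0) by exact/val_inj.
  by rewrite (@row_mxEl _ 1 1 n) mxE eqxx.
apply/rowP => j; rewrite mxE.
have -> : lift ord0 j = rshift 1 j by exact/val_inj.
by rewrite (@row_mxEr _ 1 1 n).
Qed.

Lemma consrV0 n t (v : 'rV[R]_n) : consrV (t, v) ord0 ord0 = t.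
Proof. exact: (congr1 fst (consrVK (t, v))). Qed.

Lemma consrVS n t (v : 'rV[R]_n) (j : 'I_n) :
  consrV (t, v) ord0 (lift ord0 j) = v ord0 j.
Proof.
have /= <- := congr1 (fun p : _ * 'rV[R]_n => p.2 ord0 j) (consrVK (t, v)).
by rewrite [RHS]mxE.
Qed.

Lemma unconsrVK n : cancel (@unconsrV n) (@consrV n).
Proof.
move=> v; rewrite /unconsrV /consrV /=; apply/rowP => i.
rewrite -[n.+1]/(1 + n)%N in i v *.
case: (splitP i) => j ij.
  have -> : i = lshift n j by exact/val_inj.
  by rewrite row_mxEl mxE (ord1 j) eqxx; congr (v _ _); exact/val_inj.
have -> : i = rshift 1 j by exact/val_inj.
by rewrite row_mxEr mxE; congr (v _ _); exact/val_inj.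
Qed.

Lemma measurable_unconsrV n : measurable_fun setT (@unconsrV n).
Proof.
apply/measurable_fun_pair => /=; first exact: measurable_coord.
apply/measurable_fun_rVP => j.
by under eq_fun do rewrite mxE; exact: measurable_coord.
Qed.

Section lebesgue_rV_step.
Variables (n : nat) (m : {sigma_finite_measure set 'rV[R]_n -> \bar R}).

Let step := pushforward (@lebesgue_measure R \x m)%E (@consrV n).

Let step0 : step set0 = 0%E.
Proof. by rewrite /step /pushforward preimage_set0 measure0. Qed.

Let step_ge0 A : (0 <= step A)%E.
Proof. by rewrite /step /pushforward; exact: measure_ge0. Qed.

Let mpre A : measurable A -> measurable (@consrV n @^-1` A).
Proof.
by move=> mA; rewrite -[X in measurable X]setTI; exact: measurable_consrV.
Qed.

Let step_sigma_additive : semi_sigma_additive step.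
Proof.
move=> F mF tF mUF; rewrite /step /pushforward preimage_bigcup.
apply: measure_semi_sigma_additive => [i||].
- exact: mpre.
- apply/trivIsetP => i j _ _ ij; rewrite -preimage_setI.
  by move/trivIsetP : tF => ->; rewrite ?preimage_set0.
- by rewrite -preimage_bigcup; exact: mpre.
Qed.

HB.instance Definition _ := isMeasure.Build _ _ _ step
  step0 step_ge0 step_sigma_additive.

Let step_sigma_finite : sigma_finite setT step.
Proof.
have /sigma_finiteP[F [TF ndF Foo]] := sigma_finiteT (@lebesgue_measure R).
have /sigma_finiteP[G [TG ndG Goo]] := sigma_finiteT m.
exists (fun i => @unconsrV n @^-1` (F i `*` G i)).
  apply/esym; rewrite -subTset => v _.
  have [i _ Fi] : (\bigcup_i F i) (unconsrV v).1 by rewrite -TF.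
  have [j _ Gj] : (\bigcup_i G i) (unconsrV v).2 by rewrite -TG.
  exists (maxn i j) => //; split.
    by move: Fi; exact/subsetPset/ndF/leq_maxl.
  by move: Gj; exact/subsetPset/ndG/leq_maxr.
move=> i; have [mFi Fioo] := Foo i; have [mGi Gioo] := Goo i; split.
  rewrite -[X in measurable X]setTI; apply: measurable_unconsrV => //.
  exact: measurableX.
rewrite /step /pushforward -comp_preimage.
rewrite (_ : _ \o _ = id) ?preimage_id; last exact/funext/consrVK.
by rewrite product_measure1E// lte_mul_pinfty// ge0_fin_numE.
Qed.

HB.instance Definition _ := Measure_isSigmaFinite.Build _ _ _ step
  step_sigma_finite.

Definition lebesgue_rV_step : {sigma_finite_measure set 'rV[R]_n.+1 -> \bar R} :=
  step.

End lebesgue_rV_step.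

Lemma lebesgue_rV_measureP n :
  exists m : {sigma_finite_measure set 'rV[R]_n -> \bar R},
    @lebesgue_rV n = m.
Proof.
elim: n => [|n [m IH]]; last by exists (lebesgue_rV_step m); rewrite /= IH.
by exists (@dirac _ _ (0 : 'rV[R]_0) R).
Qed.

Section lebesgue_rV_measure.
Variable n : nat.
Let mu := @lebesgue_rV n.

Let mu0 : mu set0 = 0%E.
Proof. by rewrite /mu; have [m ->] := lebesgue_rV_measureP n. Qed.

Let mu_ge0 A : (0 <= mu A)%E.
Proof. by rewrite /mu; have [m ->] := lebesgue_rV_measureP n. Qed.

Let mu_sigma_additive : semi_sigma_additive mu.
Proof.
rewrite /mu; have [m ->] := lebesgue_rV_measureP n.
exact: measure_semi_sigma_additive.
Qed.

HB.instance Definition _ := isMeasure.Build _ _ _ (@lebesgue_rV n)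
  mu0 mu_ge0 mu_sigma_additive.

Let mu_sigma_finite : sigma_finite setT mu.
Proof.
by rewrite /mu; have [m ->] := lebesgue_rV_measureP n; exact: sigma_finiteT.
Qed.

HB.instance Definition _ := Measure_isSigmaFinite.Build _ _ _ (@lebesgue_rV n)
  mu_sigma_finite.

End lebesgue_rV_measure.

End lebesgue_rV.

Arguments lebesgue_rV {R n}.

Lemma lebesgue_rV_box (R : realType) n (A : 'I_n -> set R) :
  (forall i, measurable (A i)) ->
  lebesgue_rV [set v : 'rV[R]_n | forall i, A i (v ord0 i)] =
  (\prod_(i < n) lebesgue_measure (A i))%E.
Proof.
elim: n A => [|n IH] A mA.
  rewrite big_ord0 /= diracE mem_set//; by case.
rewrite big_ord_recl /= /pushforward -IH// -product_measure1E//=; first last.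
- rewrite (_ : mkset _ = \bigcap_(i in [set: 'I_n])
    ((fun v : 'rV[R]_n => v ord0 i : measurableTypeR R) @^-1` A (lift ord0 i))).
    apply: fin_bigcap_measurable => [|i _]; first exact: finite_finset.
    by rewrite -[X in measurable X]setTI; apply: (measurable_coord i) => //; exact: mA.
  by apply/seteqP; split => v /= h i; [move=> _; exact: h|exact: (h i I)].
- exact: mA.
congr (_ _); apply/seteqP; split => -[t v] /= h.
  split=> [|i]; first by have := h ord0; rewrite consrV0.
  by have := h (lift ord0 i); rewrite consrVS.
case: h => ht hv i; case: (unliftP ord0 i) => [j|] ->.
  by rewrite consrVS; exact: hv.
by rewrite consrV0.
Qed.

Section test_functions.
Context {R : realType} {n : nat}.
Implicit Types (f : 'rV[R]_n -> R) (s : seq 'I_n) (Omega : set 'rV[R]_n).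

Definition partial (i : 'I_n) f : 'rV[R]_n -> R := 'D_(delta_mx 0 i) f.

Definition partials s f : 'rV[R]_n -> R := foldr partial f s.

Definition smooth f := forall s x, differentiable (partials s f) x.

Definition test_function Omega f :=
  smooth f /\ exists K, [/\ compact K, K `<=` Omega &
    forall x, ~ K x -> f x = 0].

Definition loc_integrable Omega f := measurable_fun Omega f /\
  forall K, compact K -> K `<=` Omega ->
    (\int[lebesgue_rV]_(x in K) `|f x|%:E < +oo)%E.

(* The L^q norm for the normalised measure on a non-null [Omega]; as
   [`|f x| >= 0], cutting [f] off outside [Omega] gives its essential supremum
   over [Omega]. *)
Definition avg_norm Omega (q : \bar R) f : \bar R :=
  match q with
  | q%:E => (((lebesgue_rV Omega)^-1 *
      \int[lebesgue_rV]_(x in Omega) (`|f x| `^ q)%:E) `^ q^-1)%E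
  | +oo%E => ess_sup lebesgue_rV (fun x => (`|f x| * \1_Omega x)%:E)
  | -oo%E => 0%E
  end.

Definition Linfty Omega f :=
  measurable_fun Omega f /\ (avg_norm Omega +oo f < +oo)%E.

End test_functions.

Section tensors.
Variables (R : realType) (N n : nat).

Definition tensor j : Type := {ptws 'I_N * j.-tuple 'I_n -> R}.

HB.instance Definition _ j := Topological.on (tensor j).
HB.instance Definition _ j := Pointed.on (tensor j).

Definition sym_tensor j : set (tensor j) :=
  [set X | forall a (I J : j.-tuple 'I_n), perm_eq I J -> X (a, I) = X (a, J)].

Definition jet k : Type := prod_topology (fun j : 'I_k.+1 => tensor j).

HB.instance Definition _ k := Topological.on (jet k).
HB.instance Definition _ k := Pointed.on (jet k).

Definition sym_jet k : set (jet k) :=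
  [set X | forall j, sym_tensor (X j)].

End tensors.

(* A map on [Omega] is represented by a function on the whole space whose
   values off [Omega] are irrelevant. Measurability is meant in the Borel
   sense: every class of a.e.-equal Lebesgue measurable functions has such a
   representative. *)
Section sobolev.
Context {R : realType} {n N : nat}.
Variable Omega : set 'rV[R]_n.
Implicit Types (u v : 'rV[R]_n -> 'rV[R]_N) (k j : nat).

Local Notation mu := (@lebesgue_rV R n).

Definition component u (a : 'I_N) : 'rV[R]_n -> R := fun x => u x ord0 a.

(* Component [(a, I)] of [G] is the weak derivative of the [a]-th component
   of [u] in the directions listed by [I]. *)
Definition weak_derivative j u (G : 'rV[R]_n -> tensor R N n j) :=
  [/\ forall x, Omega x -> sym_tensor (G x),
      forall a, loc_integrable Omega (component u a),
      forall i, loc_integrable Omega (fun x => G x i) &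
      forall a (I : j.-tuple 'I_n) f, test_function Omega f ->
        \int[mu]_(x in Omega) (component u a x * partials I f x) =
        (-1) ^+ j * \int[mu]_(x in Omega) (G x (a, I) * f x)].

(* For [j > 0] this picks a representative of the a.e.-unique weak
   derivative; the value is meaningless if there is none. *)
Definition weakD j u : 'rV[R]_n -> tensor R N n j :=
  match j with
  | 0 => fun x i => u x ord0 i.1
  | j'.+1 => xget (fun _ _ => 0) [set G | @weak_derivative j'.+1 u G]
  end.
Arguments weakD j u x : clear implicits.

Definition jet_of k u (x : 'rV[R]_n) : jet R N n k :=
  fun i : 'I_k.+1 => weakD i u x.

Definition Wkinfty k : set ('rV[R]_n -> 'rV[R]_N) :=
  [set u | forall j, (j <= k)%N -> weak_derivative u (weakD j u) /\
    forall i, Linfty Omega (fun x => weakD j u x i)].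

(* [W^{k,infty} /\ W^{k,1}_0], where [W^{k,1}_0] is the [W^{k,1}]-closure of
   the test maps. *)
Definition Wkinfty0 k : set ('rV[R]_n -> 'rV[R]_N) :=
  [set v | Wkinfty k v /\
    exists psi : nat -> 'rV[R]_n -> 'rV[R]_N,
      (forall m a, test_function Omega (component (psi m) a)) /\
      forall j a (I : j.-tuple 'I_n), (j <= k)%N ->
        (fun m => \int[mu]_(x in Omega)
           `|weakD j v x (a, I) - partials I (component (psi m) a) x|%:E)%E
        @ \oo --> 0%E].

Definition Wkinfty_bc k phi : set ('rV[R]_n -> 'rV[R]_N) :=
  [set phi \+ v | v in Wkinfty0 k].

End sobolev.
Arguments weakD {R n N} Omega j u x.
Arguments jet_of {R n N} Omega k u x.

Section problem.
Context {R : realType} {n N k : nat}.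
Variables (Omega : set 'rV[R]_n) (H : 'rV[R]_n * jet R N n k -> R).
Implicit Types (u phi : 'rV[R]_n -> 'rV[R]_N).

Definition energy (q : \bar R) u : \bar R :=
  avg_norm Omega q (fun x => H (x, jet_of Omega k u x)).

(* [H] is only continuous on the open set [Omega], hence may blow up at its
   boundary and both energies may be infinite. In [\bar R] the quotient
   [+oo / +oo] is [0]; it is replaced by [+oo], the value of the quotient
   when the numerator alone is infinite. *)
Definition condition_number (p : R) u : \bar R :=
  if energy +oo u == +oo%E then +oo%E else (energy +oo u / energy p%:E u)%E.

Definition is_minimiser (p : R) phi u :=
  energy 1%E u != 0%E /\
  condition_number p u =
    ereal_inf [set condition_number p v | v in
      Wkinfty_bc Omega k phi `&` [set v | energy 1%E v != 0%E]].

Definition dirichlet_solution phi (L : R) u :=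
  Wkinfty_bc Omega k phi u /\
  {ae lebesgue_rV, forall x, Omega x -> `|H (x, jet_of Omega k u x)| = L}.

End problem.

(* Main.v *)
(* For every admissible [u] with [E_1(u) <> 0] one has [0 < E_infty(u)] and
   [E_p(u) <= E_infty(u)], so [C_{infty,p}(u) >= 1]; when [E_infty(u)] is
   finite, equality forces the nonnegative function
   [E_infty(u)^p - |H(., u, ..., D^k u)|^p] to have zero integral, that is
   [|H(., u, ..., D^k u)| = E_infty(u)] almost everywhere. Solvability of a
   single problem [(P_L)], [L > 0], shows that the infimum is the value [1], so
   minimisers are exactly the admissible maps of constant [|H|]. The only other
   point is measurability of [x |-> H(x, u(x), ..., D^k u(x))], for which one
   needs that [u = phi + v] has weak derivatives. *)

Require Import Defs.
From mathcomp Require Import all_boot all_order all_algebra.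
From mathcomp Require Import all_classical all_reals all_analysis.
From mathcomp Require Import measurable_realfun ess_sup_inf.

Import Order.TTheory GRing.Theory Num.Theory.
Import numFieldNormedType.Exports.

Local Open Scope classical_set_scope.
Local Open Scope ring_scope.

(** * Neighbourhoods of jets and row vectors in coordinates *)

(** The product topology is the supremum of the topologies induced by the projections, so
    convergence is tested in each of them. *)
Lemma prod_topology_cvg {I : Type} (K : I -> topologicalType)
    (F : set_system (prod_topology K)) (f : prod_topology K) :
  Filter F -> (forall i, (fun g : prod_topology K => g i) @ F --> f i) ->
  F --> f.
Proof.
move=> FF cvF; apply/cvg_sup => i A.
rewrite nbhsE => -[B [[C oC <-] Cf] BA].
by apply: filterS BA _; apply: (cvF i); exact: open_nbhs_nbhs.
Qed.

(** Indexes all scalar components of a jet; finiteness keeps the family of rational boxes used below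
    countable. *)
Definition jet_coord (n N k : nat) : finType :=
  {j : 'I_k.+1 & ('I_N * j.-tuple 'I_n)%type}.

(** The filter generated by the sup-distance balls about [X] converges in every component, hence in
    the two nested product topologies. *)
Lemma nbhs_jet {R : realType} {n N k : nat} (X : jet R N n k)
    (V : set (jet R N n k)) : nbhs X V ->
  exists2 e : R, 0 < e & forall Y : jet R N n k,
    (forall s : jet_coord n N k,
       `|Y (tag s) (tagged s) - X (tag s) (tagged s)| < e) -> V Y.
Proof.
pose F := filter_from [set e : R | 0 < e] (fun e => [set Y : jet R N n k |
  forall s : jet_coord n N k,
    `|Y (tag s) (tagged s) - X (tag s) (tagged s)| < e]).
have FF : Filter F.
  apply: filter_from_filter; first by exists 1 => /=.
  move=> e1 e2 /= e10 e20; exists (Num.min e1 e2); first by rewrite lt_min e10.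
  by move=> Y /= YX; split => s; have := YX s; rewrite lt_min => /andP[].
suff cvF : F --> X by move=> /cvF.
apply: prod_topology_cvg => j; apply: prod_topology_cvg => i.
apply/cvgrPdist_lt => e e0; exists e => //= Y YX /=.
rewrite distrC.
exact: (YX (Tagged (fun j : 'I_k.+1 => ('I_N * j.-tuple 'I_n)%type) i)).
Qed.

Lemma nbhs_rV {R : realType} {n : nat} (x : 'rV[R]_n) (V : set 'rV[R]_n) :
  nbhs x V -> exists2 e : R, 0 < e &
    forall y : 'rV[R]_n, (forall i, `|y ord0 i - x ord0 i| < e) -> V y.
Proof.
move=> /nbhs_ballP[e /= e0 eV]; exists e => // y yx; apply: eV; split=> // i j.
by rewrite ord1 /ball /= distrC.
Qed.

(** * Measurability through real coordinates *)

(** Stands in for Borel measurability, as [Y] carries no sigma-algebra: [V] is open for the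
    sup-distance of the coordinates [c], and these are measurable along [g]. Applied to row vectors
    and to pairs of a point and a jet. *)
Lemma measurable_preimage_coord {d} {T : measurableType d} {R : realType}
    {Y : Type} {I : finType} (c : I -> Y -> R) (D : set T) (g : T -> Y)
    (V : set Y) :
  measurable D ->
  (forall i, measurable_fun D (fun t => c i (g t) : measurableTypeR R)) ->
  (forall y, V y -> exists2 e : R, 0 < e &
     forall y', (forall i, `|c i y' - c i y| < e) -> V y') ->
  measurable (D `&` g @^-1` V).
Proof.
move=> mD mc cV.
pose box (q : {ffun I -> rat * rat}) : set Y :=
  [set y | forall i, ratr (q i).1 < c i y < ratr (q i).2].
(* [V] is the union of the countably many rational boxes that it contains. *)
rewrite [X in measurable X](_ : _ = \bigcup_(q : {ffun I -> rat * rat})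
   (if `[< box q `<=` V >] then D `&` g @^-1` box q else set0)); last first.
  apply/seteqP; split => [t [Dt Vt]|t [q _]]; last first.
    by case: asboolP => // qV [Dt qt]; split => //; exact: qV.
  have [e e0 eV] := cV _ Vt.
  have qi i : exists q : rat * rat,
      c i (g t) - e < ratr q.1 < c i (g t) /\
      c i (g t) < ratr q.2 < c i (g t) + e.
    have lt1 : c i (g t) - e < c i (g t) by rewrite ltrBlDr ltrDl.
    have lt2 : c i (g t) < c i (g t) + e by rewrite ltrDl.
    have [b] := rat_in_itvoo lt2; have [a] := rat_in_itvoo lt1.
    by rewrite !in_itv /= => hb ha; exists (a, b).
  have [q hq] := choice qi.
  exists [ffun i => q i] => //.
  rewrite asboolT.
    split => // i /=; rewrite ffunE.
    by have [/andP[_ ->] /andP[-> _]] := hq i.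
  move=> y hy; apply: eV => i; have := hy i; rewrite ffunE => /andP[y1 y2].
  have [/andP[h1 _] /andP[_ h2]] := hq i.
  by rewrite ltr_distl (lt_trans h1 y1) (lt_trans y2 h2).
apply: countable_bigcupT_measurable => [|q]; first exact: countableP.
case: asboolP => // _.
(* The outer [D] covers an empty [I], over which the intersection is the whole space. *)
rewrite [X in measurable X](_ : _ = D `&` \bigcap_(i in [set: I])
   (D `&` (fun t => c i (g t)) @^-1` `]ratr (q i).1, ratr (q i).2[)).
  apply: measurableI => //; apply: fin_bigcap_measurable => [|i _].
    exact: finite_finset.
  by apply: mc => //; exact: measurable_itv.
apply/seteqP; split => t [Dt qt]; split => //= i.
  by move=> _; split => //=; rewrite in_itv /=; exact: qt.
by have [_ /=] := qt i Logic.I; rewrite in_itv.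
Qed.

Lemma measurable_open_rV {R : realType} {n : nat} (V : set 'rV[R]_n) :
  open V -> measurable V.
Proof.
move=> oV; rewrite -[V]setTI -[V]preimage_id.
apply: (@measurable_preimage_coord _ _ R _ _
  (fun i (v : 'rV[R]_n) => v ord0 i)) => //.
  exact: measurable_coord.
by move=> y Vy; apply: nbhs_rV; exact: open_nbhs_nbhs.
Qed.

Lemma measurable_closed_rV {R : realType} {n : nat} (V : set 'rV[R]_n) :
  closed V -> measurable V.
Proof.
move=> cV; rewrite -[V]setCK; apply: measurableC; apply: measurable_open_rV.
exact: closed_openC.
Qed.

Lemma compact_closed_rV {R : realType} {n : nat} (K : set 'rV[R]_n) :
  compact K -> closed K.
Proof. by apply: compact_closed; exact: (@norm_hausdorff _ 'rV[R]_n). Qed.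

Lemma measurable_compact_rV {R : realType} {n : nat} (K : set 'rV[R]_n) :
  compact K -> measurable K.
Proof.
by move=> cK; apply: measurable_closed_rV; exact: compact_closed_rV.
Qed.

Lemma measurable_fun_open {d} {T : measurableType d} {R : realType}
    (D : set T) (f : T -> R) :
  (forall U : set R, open U -> measurable (D `&` f @^-1` U)) ->
  measurable_fun D (f : T -> measurableTypeR R).
Proof.
move=> oU; apply: (@measurability _ _ T (measurableTypeR R) D f _
  (@RGenOpens.measurableE R)).
by move=> _ [_ [a [b ->]] <-]; apply: oU; exact: interval_open.
Qed.

Lemma continuous_measurable_rV {R : realType} {n : nat} (f : 'rV[R]_n -> R) :
  continuous f -> measurable_fun setT (f : _ -> measurableTypeR R).
Proof.
move=> cf; apply: measurable_fun_open => U oU; rewrite setTI.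
by apply: measurable_open_rV; move/continuousP : cf; exact.
Qed.

(** Continuity of [H] on a subspace only makes the preimage of an open set the trace of an open [W].
    Over [Omega] the graph of [J] stays in that subspace, so [W] itself can be pulled back. *)
Lemma measurable_fun_jet_comp {R : realType} {n N k : nat}
    {Omega : set 'rV[R]_n} (H : 'rV[R]_n * jet R N n k -> R)
    (J : 'rV[R]_n -> jet R N n k) :
  open Omega ->
  {within Omega `*` sym_jet (k := k), continuous H} ->
  (forall x, Omega x -> sym_jet (J x)) ->
  (forall j i, measurable_fun Omega (fun x => J x j i)) ->
  measurable_fun Omega (fun x => H (x, J x)).
Proof.
move=> oO Hc Jsym mJ; apply: measurable_fun_open => U oU.
have /open_subspaceP[W oW WE] :
    open (H @^-1` U : set (subspace (Omega `*` sym_jet (k := k)))).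
  by move/continuousP : Hc; exact.
rewrite (_ : _ `&` _ = Omega `&` (fun x => (x, J x)) @^-1` W); last first.
  apply/seteqP; split => x [Ox] /= h; split => //.
    suff : (W `&` (Omega `*` sym_jet (k := k))) (x, J x) by case.
    by rewrite WE; split => //; split => //; exact: Jsym.
  suff : (H @^-1` U `&` (Omega `*` sym_jet (k := k))) (x, J x) by case.
  by rewrite -WE; split => //; split => //; exact: Jsym.
pose c (s : 'I_n + jet_coord n N k) (y : 'rV[R]_n * jet R N n k) : R :=
  match s with
  | inl i => y.1 ord0 i
  | inr s => y.2 (tag s) (tagged s)
  end.
apply: (@measurable_preimage_coord _ _ R _ _ c) => //.
- exact: measurable_open_rV.
- case=> [i|s]; last exact: mJ.
  exact: measurable_funTS (measurable_coord i).
- case=> x X Wx.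
  have /= [[A B] /= [nA nB] AB] : nbhs (x, X) W by exact: open_nbhs_nbhs.
  have [e1 e10 eA] := nbhs_rV _ _ nA; have [e2 e20 eB] := nbhs_jet _ _ nB.
  exists (Num.min e1 e2); first by rewrite lt_min e10.
  case=> y Y yY; apply: AB; split => /=.
    by apply: eA => i; have := yY (inl i); rewrite lt_min => /andP[].
  by apply: eB => s; have := yY (inr s); rewrite lt_min => /andP[].
Qed.

(** * Test functions and weak derivatives of sums *)

(** Differentiation is local: [K] is closed, so off [K] the function to be differentiated vanishes
    near [x]. *)
Lemma partials_eq0 {R : realType} {n : nat} (f : 'rV[R]_n -> R)
    (K : set 'rV[R]_n) (s : seq 'I_n) :
  compact K -> (forall x, ~ K x -> f x = 0) ->
  forall x, ~ K x -> partials s f x = 0.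
Proof.
move=> cK f0; elim: s => [|i s IH] x Kx; first exact: f0.
rewrite /partials /= /partial.
have oK : open (~` K).
  by apply: closed_openC; exact: compact_closed_rV.
rewrite (@near_eq_derive _ _ _ _ (cst 0)) ?derive_cst//.
near=> y; apply: IH; near: y.
exact: (open_nbhs_nbhs (conj oK Kx)).
Unshelve. all: by end_near. Qed.

Lemma continuous_partials {R : realType} {n : nat} (f : 'rV[R]_n -> R) s :
  smooth f -> continuous (partials s f).
Proof. by move=> sf x; apply: differentiable_continuous; exact: sf. Qed.

Lemma partials_bounded {R : realType} {n : nat} (Omega : set 'rV[R]_n)
    (f : 'rV[R]_n -> R) (s : seq 'I_n) : test_function Omega f ->
  exists K, [/\ compact K, K `<=` Omega & exists M : R, 0 <= M /\
    forall x, `|partials s f x| <= M * \1_K x].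
Proof.
move=> [sf [K [cK KO f0]]]; exists K; split => //.
have : compact (partials s f @` K).
  apply: continuous_compact cK; apply: continuous_subspaceT.
  exact: continuous_partials.
move=> /(@compact_bounded _ R^o) [M [_ HM]].
(* The bound from compactness holds for numbers strictly above [M]; this one is also nonnegative. *)
exists (`|M| + 1); split; first by rewrite addr_ge0.
move=> x; rewrite indicE; have [Kx|Kx] := pselect (K x).
  rewrite mem_set// mulr1; apply: HM; last by exists x.
  by rewrite (le_lt_trans (ler_norm M))// ltrDl.
by rewrite memNset// mulr0 (partials_eq0 f K)// normr0.
Qed.

(** On a compact [K] outside which it vanishes the derivative is bounded and [g] is integrable, so a
    multiple of [g] cut off outside [K] dominates the product. *)
Lemma integrable_mul_partials {R : realType} {n : nat} (Omega : set 'rV[R]_n)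
    (g f : 'rV[R]_n -> R) (s : seq 'I_n) :
  measurable Omega -> loc_integrable Omega g -> test_function Omega f ->
  lebesgue_rV.-integrable Omega (EFin \o (fun x => g x * partials s f x)).
Proof.
move=> mO [mg ig] tf.
have [K [cK KO [M [M0 HM]]]] := partials_bounded _ _ s tf.
have mK := measurable_compact_rV _ cK.
have iK : lebesgue_rV.-integrable K (EFin \o g).
  apply/integrableP; split; last exact: ig.
  by apply/measurable_EFinP; exact: measurable_funS mg.
apply: (@le_integrable _ _ _ _ _ mO _ (fun x => M%:E * ((EFin \o g) \_ K) x)%E).
- apply/measurable_EFinP; apply: measurable_funM => //.
  apply: measurable_funTS; apply: continuous_measurable_rV.
  by apply: continuous_partials; case: tf.
- move=> x Ox; rewrite patchE /=; have := HM x; rewrite indicE.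
  case: ifPn => xK; rewrite ?mulr1 ?mulr0 => h.
    by rewrite lee_fin !normrM mulrC ler_wpM2r// (le_trans h)// ler_norm.
  by rewrite normr_le0 in h; rewrite (eqP h) mulr0 mule0 abse0 normr0.
- apply: integrableZl => //; apply: (integrableS measurableT) => //.
  by apply/(integrable_mkcond (EFin \o g) mK).
Qed.

Lemma loc_integrableD {R : realType} {n : nat} (Omega : set 'rV[R]_n)
    (f g : 'rV[R]_n -> R) : measurable Omega ->
  loc_integrable Omega f -> loc_integrable Omega g ->
  loc_integrable Omega (f \+ g).
Proof.
move=> mO [mf If] [mg Ig]; split; first exact: measurable_funD.
move=> K cK KO; have mK := measurable_compact_rV _ cK.
have iK (h : 'rV[R]_n -> R) : measurable_fun Omega h ->
    (\int[lebesgue_rV]_(x in K) `|h x|%:E < +oo)%E ->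
    lebesgue_rV.-integrable K (EFin \o h).
  move=> mh Ih; apply/integrableP; split => //.
  by apply/measurable_EFinP; exact: measurable_funS mh.
by have /integrableP[_] :=
  integrableD mK (iK _ mf (If K cK KO)) (iK _ mg (Ig K cK KO)).
Qed.

(** Both sides of the defining identity are additive, every product in it being integrable. *)
Lemma weak_derivativeD {R : realType} {n N j : nat} (Omega : set 'rV[R]_n)
    (u v : 'rV[R]_n -> 'rV[R]_N) (G F : 'rV[R]_n -> tensor R N n j) :
  measurable Omega ->
  weak_derivative Omega u G -> weak_derivative Omega v F ->
  weak_derivative Omega (u \+ v)
    (fun x => (fun i => G x i + F x i) : tensor R N n j).
Proof.
move=> mO [sG lu lG wG] [sF lv lF wF].
have compD a : component (u \+ v) a = component u a \+ component v a.
  by apply/funext => x; rewrite /component /= mxE.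
split.
- by move=> x Ox a I J IJ; rewrite (sG x Ox a I J IJ) (sF x Ox a I J IJ).
- by move=> a; rewrite compD; exact: loc_integrableD.
- by move=> i; exact: loc_integrableD.
move=> a I f tf.
(* The empty list of directions leaves [f] itself. *)
have tf0 (h : 'rV[R]_n -> R) := integrable_mul_partials Omega h f [::] mO.
under eq_Rintegral do rewrite compD mulrDl.
under [in RHS]eq_Rintegral do rewrite mulrDl.
rewrite !RintegralD//; [|exact: tf0|exact: tf0|exact: integrable_mul_partials..].
by rewrite wG// wF// mulrDr.
Qed.

(** [weakD] is meaningful once some weak derivative exists; the sum of those of [phi] and [v] is
    one. *)
Lemma Wkinfty_bc_weakD {R : realType} {n N k : nat} (Omega : set 'rV[R]_n)
    (phi u : 'rV[R]_n -> 'rV[R]_N) : measurable Omega ->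
  Wkinfty Omega k phi -> Wkinfty_bc Omega k phi u ->
  forall j, (j <= k)%N -> weak_derivative Omega u (weakD Omega j u).
Proof.
move=> mO phiW [v [vW _] <-] j jk.
have := weak_derivativeD _ _ _ _ _ mO (phiW j jk).1 (vW j jk).1.
(* For positive order [xget] returns a weak derivative as soon as there is one; at order 0 [weakD]
   is the map itself. *)
case: j {jk} => [|j] /= h; last by apply: xgetPex; eexists; exact: h.
congr (weak_derivative _ _ _) : h; apply/funext => x; apply/funext => i.
by rewrite mxE.
Qed.

(** * Lebesgue measure of open and of bounded sets *)

Lemma measurable_box_rV {R : realType} {n : nat} (B : 'I_n -> set R) :
  (forall i, measurable (B i)) ->
  measurable [set v : 'rV[R]_n | forall i, B i (v ord0 i)].
Proof.
move=> mB.
rewrite (_ : mkset _ = \bigcap_(i in [set: 'I_n])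
  ((fun v : 'rV[R]_n => v ord0 i) @^-1` B i)).
  apply: fin_bigcap_measurable => [|i _]; first exact: finite_finset.
  rewrite -[X in measurable X]setTI.
  by apply: (measurable_coord i) => //; exact: mB.
by apply/seteqP; split => v /= h i; [move=> _; exact: h|exact: (h i Logic.I)].
Qed.

(** A cube of side [2e] about [x] lies in [U] and has positive volume. *)
Lemma lebesgue_rV_open_gt0 {R : realType} {n : nat} (U : set 'rV[R]_n) :
  open U -> U !=set0 -> (0 < lebesgue_rV U)%E.
Proof.
move=> oU [x Ux]; have [e e0 eU] := nbhs_rV x U (open_nbhs_nbhs (conj oU Ux)).
pose B : 'I_n -> set R := fun i => `]x ord0 i - e, x ord0 i + e[%classic.
have mB i : measurable (B i) by exact: measurable_itv.
have BE i : lebesgue_measure (B i) = (e *+ 2)%:E.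
  rewrite lebesgue_measure_itv /= lte_fin ltrD2l.
  by rewrite ifT ?gtrN// -EFinB opprD opprK addrACA subrr add0r -mulr2n.
have BU : [set v : 'rV[R]_n | forall i, B i (v ord0 i)] `<=` U.
  move=> v /= Bv; apply: eU => i; rewrite ltr_distl.
  by have := Bv i; rewrite /B /= in_itv.
apply: (@lt_le_trans _ _
  (lebesgue_rV [set v : 'rV[R]_n | forall i, B i (v ord0 i)])).
  rewrite lebesgue_rV_box//.
  under eq_bigr do rewrite BE.
  by rewrite prodEFin lte_fin prodr_gt0// => i _; rewrite mulrn_wgt0.
apply: le_measure BU; rewrite inE; last exact: measurable_open_rV.
exact: measurable_box_rV.
Qed.

(** The norm of a row vector is its largest absolute entry, so a bounded set lies in a cube of
    finite volume about the origin. *)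
Lemma lebesgue_rV_bounded {R : realType} {n : nat} (A : set 'rV[R]_n) :
  measurable A -> bounded_set A -> (lebesgue_rV A < +oo)%E.
Proof.
move=> mA [M [_ AM]].
pose M1 := `|M| + 1.
pose B : 'I_n -> set R := fun=> `[- M1, M1]%classic.
have mB i : measurable (B i) by exact: measurable_itv.
have AB : A `<=` [set v : 'rV[R]_n | forall i, B i (v ord0 i)].
  move=> v Av i; rewrite /B /= in_itv /= -ler_norml.
  have : `|v| <= M1.
    by apply: AM => //; rewrite (le_lt_trans (ler_norm M))// ltrDl.
  apply: le_trans; rewrite [leRHS]mx_normrE.
  exact: (le_bigmax _ (fun ij : 'I_1 * 'I_n => `|v ij.1 ij.2|) (ord0, i)).
apply: (@le_lt_trans _ _
  (lebesgue_rV [set v : 'rV[R]_n | forall i, B i (v ord0 i)])).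
  apply: le_measure AB; rewrite inE //.
  exact: measurable_box_rV.
rewrite lebesgue_rV_box// ltey_eq prode_fin_num// => i _.
by rewrite lebesgue_measure_itv /=; case: ifP.
Qed.

(** * The averaged norm for a finite exponent and its equality case *)

Lemma powR_invK {R : realType} (x p : R) : 0 <= x -> p != 0 ->
  (x `^ p) `^ p^-1 = x.
Proof. by move=> x0 p0; rewrite -powRrM mulfV// powRr1. Qed.

Section avg_norm.
Context {R : realType} {n : nat}.
Variables (Omega : set 'rV[R]_n) (p : R) (f : 'rV[R]_n -> R).
Hypotheses (mO : measurable Omega) (O_gt0 : (0 < lebesgue_rV Omega)%E)
  (O_fin : (lebesgue_rV Omega < +oo)%E) (p_gt0 : 0 < p)
  (mf : measurable_fun Omega f).

Local Notation mu := (@lebesgue_rV R n).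

Let m := fine (mu Omega).

Let muE : mu Omega = m%:E.
Proof. by rewrite fineK// ge0_fin_numE// ltW. Qed.

Let m_gt0 : 0 < m.
Proof. by rewrite -lte_fin -muE. Qed.

Let p_neq0 : p != 0. Proof. exact: lt0r_neq0. Qed.

Let measurable_pow : measurable_fun Omega (fun x => (`|f x| `^ p)%:E).
Proof.
apply/measurable_EFinP; apply: (measurableT_comp (measurable_powR _)).
exact: measurableT_comp.
Qed.

Let integral_powM M : (\int[mu]_(x in Omega) (M `^ p)%:E = (M `^ p * m)%:E)%E.
Proof. by rewrite integral_cst// -[X in (_ * X)%E]/(mu Omega) muE. Qed.

(** The value [M = 0] is included: through it a vanishing essential supremum will give a vanishing
    [energy 1]. *)
Lemma avg_norm_cst M : 0 <= M -> {ae mu, forall x, Omega x -> `|f x| = M} ->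
  avg_norm Omega p%:E f = M%:E.
Proof.
move=> M0 fM; rewrite /avg_norm.
have -> : (\int[mu]_(x in Omega) (`|f x| `^ p)%:E =
           \int[mu]_(x in Omega) (M `^ p)%:E)%E.
  apply: ge0_ae_eq_integral => //.
  - by move=> x _; rewrite lee_fin powR_ge0.
  - by apply: filterS fM => x fxM Ox; rewrite fxM.
rewrite integral_powM muE inver gt_eqF// -EFinM mulrCA mulVf ?gt_eqF// mulr1.
by rewrite poweR_EFin powR_invK.
Qed.

Section upper_bound.
Variable M : R.
Hypotheses (M_ge0 : 0 <= M)
  (fM : {ae mu, forall x, Omega x -> `|f x| <= M}).

Let integral_pow_le :
  (\int[mu]_(x in Omega) (`|f x| `^ p)%:E <= (M `^ p * m)%:E)%E.
Proof.
rewrite -integral_powM; apply: ae_ge0_le_integral => //.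
- by move=> x _; rewrite lee_fin powR_ge0.
- apply: filterS fM => x fxM Ox; rewrite lee_fin.
  by rewrite ge0_ler_powR ?nnegrE ?(ltW p_gt0)//; exact: fxM.
Qed.

Let a := fine (\int[mu]_(x in Omega) (`|f x| `^ p)%:E).

Let aE : (\int[mu]_(x in Omega) (`|f x| `^ p)%:E = a%:E)%E.
Proof.
rewrite fineK// ge0_fin_numE ?(le_lt_trans integral_pow_le) ?ltry//.
by apply: integral_ge0 => x _; rewrite lee_fin powR_ge0.
Qed.

Let a_ge0 : 0 <= a.
Proof.
by rewrite -lee_fin -aE; apply: integral_ge0 => x _; rewrite lee_fin powR_ge0.
Qed.

Let avg_normE : avg_norm Omega p%:E f = ((m^-1 * a) `^ p^-1)%:E.
Proof. by rewrite /avg_norm aE muE inver gt_eqF// -EFinM poweR_EFin. Qed.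

(** The normalised measure has mass 1 on [Omega], so the mean of |f|^p is at most M^p. *)
Lemma avg_norm_le : (avg_norm Omega p%:E f <= M%:E)%E.
Proof.
rewrite avg_normE lee_fin -[leRHS](@powR_invK _ M p)//.
have am : a <= M `^ p * m by rewrite -lee_fin -aE.
rewrite ge0_ler_powR ?nnegrE ?powR_ge0 ?invr_ge0 ?(ltW p_gt0)//.
  by rewrite mulr_ge0// invr_ge0 ltW.
by rewrite ler_pdivrMl// mulrC.
Qed.

(** If the mean of |f|^p attains its bound M^p, the deficit M^p - |f|^p has zero integral and
    vanishes almost everywhere. *)
Lemma avg_norm_eq_ae : avg_norm Omega p%:E f = M%:E ->
  {ae mu, forall x, Omega x -> `|f x| = M}.
Proof.
rewrite avg_normE => -[aM].
have {}aM : a = M `^ p * m.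
  rewrite -aM -powRrM mulVf// powRr1 ?mulr_ge0 ?invr_ge0 ?(ltW m_gt0)//.
  by rewrite mulrAC mulVf ?gt_eqF// mul1r.
(* Truncated at [0] because [fM] holds only almost everywhere. *)
pose g x := Num.max (M `^ p - `|f x| `^ p) 0.
have g_ge0 x : 0 <= g x by rewrite le_max lexx orbT.
have mg : measurable_fun Omega (fun x => (g x)%:E).
  apply/measurable_EFinP; apply: measurable_maxr => //.
  by apply: measurable_funB => //; apply/measurable_EFinP.
(* Adding the deficit [g], rather than subtracting, keeps all integrands nonnegative. *)
have : (\int[mu]_(x in Omega) (`|f x| `^ p)%:E +
        \int[mu]_(x in Omega) (g x)%:E = (M `^ p * m)%:E)%E.
  rewrite -ge0_integralD//; last first.
    by move=> x _; rewrite lee_fin; exact: g_ge0.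
  rewrite -integral_powM; apply: ge0_ae_eq_integral => //.
  - exact: emeasurable_funD.
  - by move=> x _; rewrite -EFinD lee_fin addr_ge0// powR_ge0.
  - by move=> x _; rewrite lee_fin powR_ge0.
  - apply: filterS fM => x fxM Ox; rewrite -EFinD /g max_l ?subrKC//.
    by rewrite subr_ge0 ge0_ler_powR ?nnegrE ?(ltW p_gt0)//; exact: fxM.
rewrite aE -aM => ag.
have {ag} g0 : (\int[mu]_(x in Omega) (g x)%:E = 0)%E.
  move: ag; case: (\int[mu]_(x in Omega) (g x)%:E)%E => [r||] //.
  by rewrite -EFinD => -[] /eqP; rewrite -subr_eq0 addrAC subrr add0r => /eqP ->.
have /(ae_eq_integral_abs mu mO mg) : (\int[mu]_(x in Omega) `|(g x)%:E| = 0)%E.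
  rewrite -g0; apply: eq_integral => x _; rewrite gee0_abs// lee_fin.
  exact: g_ge0.
move=> {}g0; apply: (filterS2 _ _ fM g0) => x fxM gx Ox.
move: fxM gx => /(_ Ox) fxM /(_ Ox)[gx].
(* The vanishing maximum gives M^p <= |f x|^p; taking [p]-th roots yields the missing inequality. *)
apply/eqP; rewrite eq_le fxM/= -(powR_invK `|f x| p)// -(powR_invK M p)//.
rewrite ge0_ler_powR ?nnegrE ?powR_ge0 ?invr_ge0 ?(ltW p_gt0)//.
by rewrite -subr_le0 -gx le_max lexx.
Qed.
End upper_bound.

End avg_norm.

(** * The essential supremum norm *)

Section avg_normy.
Context {R : realType} {n : nat}.
Variables (Omega : set 'rV[R]_n) (f : 'rV[R]_n -> R).
Hypotheses (mO : measurable Omega) (O_gt0 : (0 < lebesgue_rV Omega)%E).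

Local Notation mu := (@lebesgue_rV R n).

(** Over a null space the essential supremum would be [-oo]; the whole space has positive measure
    because [Omega] has. *)
Lemma avg_normy_ge0 : (0 <= avg_norm Omega +oo f)%E.
Proof.
apply: ess_sup_gee.
  by apply: (lt_le_trans O_gt0); apply: le_measure => //; rewrite inE.
by apply: nearW => x; rewrite lee_fin mulr_ge0.
Qed.

Lemma avg_normy_ae : {ae mu, forall x, Omega x ->
  (`|f x|%:E <= avg_norm Omega +oo f)%E}.
Proof.
apply: filterS (ess_sup_ge mu (fun x => (`|f x| * \1_Omega x)%:E)) => x + Ox.
by rewrite indicE mem_set// mulr1.
Qed.

Lemma avg_normy_cst M : 0 <= M -> {ae mu, forall x, Omega x -> `|f x| = M} ->
  avg_norm Omega +oo f = M%:E.
Proof.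
move=> M0 fM; apply/eqP; rewrite eq_le; apply/andP; split.
  apply/ess_supP; apply: filterS fM => x fxM; rewrite lee_fin indicE.
  by case: (boolP (x \in Omega)) => [/set_mem/fxM ->|_]; rewrite ?mulr1 ?mulr0.
rewrite leNgt; apply/negP => ltM.
(* Were the supremum below [M], the value |f| = M would exceed it almost everywhere on [Omega],
   which would then be negligible. *)
have aeC : {ae mu, forall x, (~` Omega) x}.
  apply: (filterS2 _ _ fM avg_normy_ae) => x fxM fle Ox.
  by move: (fle Ox); rewrite fxM// leNgt ltM.
have : mu.-negligible (~` ~` Omega) by exact: aeC.
rewrite setCK.
by move/negligibleP => /(_ mO) O0; move: O_gt0; rewrite O0 ltxx.
Qed.

End avg_normy.

(** * Lower bound and equality case for the condition number *)

Section condition_number.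
Context {R : realType} {n N k : nat}.
Variables (Omega : set 'rV[R]_n) (H : 'rV[R]_n * jet R N n k -> R) (p : R)
  (u : 'rV[R]_n -> 'rV[R]_N).

Local Notation mu := (@lebesgue_rV R n).
Local Notation f := (fun x => H (x, jet_of Omega k u x)).

Hypotheses (mO : measurable Omega) (O_gt0 : (0 < mu Omega)%E)
  (O_fin : (mu Omega < +oo)%E) (p_gt0 : 0 < p) (mf : measurable_fun Omega f).

Lemma condition_number_cst L : 0 < L ->
  {ae mu, forall x, Omega x -> `|f x| = L} ->
  condition_number Omega H p u = 1%E.
Proof.
move=> L0 fL; rewrite /condition_number /energy.
rewrite (avg_norm_cst _ _ _ mO O_gt0 O_fin p_gt0 mf _ (ltW L0) fL).
rewrite (avg_normy_cst _ _ mO O_gt0 _ (ltW L0) fL) /=.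
by rewrite divee// eqe gt_eqF.
Qed.

(** A zero essential supremum would force [f] to vanish almost everywhere on [Omega], hence
    [energy 1] to be 0. *)
Lemma energyy_gt0 : energy Omega H 1%:E u != 0%E ->
  energy Omega H +oo u != +oo%E ->
  exists M : R, [/\ 0 < M, energy Omega H +oo u = M%:E &
    {ae mu, forall x, Omega x -> `|f x| <= M}].
Proof.
rewrite /energy => f0 foo; have := avg_normy_ae Omega f.
have := avg_normy_ge0 Omega f mO O_gt0; move: foo.
case: (avg_norm Omega +oo f) => [M||] // _; rewrite lee_fin => M0 fM.
exists M; split => //; rewrite lt_neqAle M0 andbT; apply: contra f0 => /eqP M00.
apply/eqP; apply: (avg_norm_cst _ _ _ mO) => //.
apply: filterS fM => x + Ox => /(_ Ox); rewrite lee_fin -M00 => fx0.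
by apply/eqP; rewrite eq_le fx0 normr_ge0.
Qed.

Lemma condition_number_ge1 : energy Omega H 1%:E u != 0%E ->
  (1 <= condition_number Omega H p u)%E.
Proof.
move=> f0; rewrite /condition_number.
case: eqVneq => [_|/(energyy_gt0 f0)]; first exact: leey.
move=> [M [M0 -> fM]].
have := avg_norm_le _ _ _ mO O_gt0 O_fin p_gt0 mf _ (ltW M0) fM.
rewrite -/(energy Omega H p%:E u).
have : (0 <= energy Omega H p%:E u)%E by exact: poweR_ge0.
case: (energy _ _ _ _) => [a||] //; rewrite !lee_fin => a0 aM.
(* The inverse of 0 in [\bar R] is [+oo], so a vanishing [energy p] makes the quotient infinite. *)
rewrite inver; case: eqVneq => [_|an0]; first by rewrite gt0_muley// leey.
by rewrite lee_fin ler_pdivlMr ?mul1r// lt_neqAle eq_sym an0.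
Qed.

Lemma condition_number_eq1 : energy Omega H 1%:E u != 0%E ->
  condition_number Omega H p u = 1%E -> exists2 L : R, 0 < L &
    {ae mu, forall x, Omega x -> `|f x| = L}.
Proof.
move=> f0; rewrite /condition_number; case: eqVneq => [//|/(energyy_gt0 f0)].
move=> [M [M0 -> fM]] q1; exists M => //.
apply: (avg_norm_eq_ae _ _ _ mO O_gt0 O_fin p_gt0 mf) => //; first exact: ltW.
rewrite -/(energy Omega H p%:E u).
move: q1; have : (0 <= energy Omega H p%:E u)%E by exact: poweR_ge0.
(* Neither extreme value of [energy p] is compatible with quotient 1: dividing by [+oo] gives 0,
   dividing by 0 gives [+oo]. *)
case: (energy _ _ _ _) => [a||] //=; last first.
  by rewrite invey mule0 => _ /eqP; rewrite eqe eq_sym oner_eq0.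
rewrite lee_fin inver => a0; case: eqVneq => [_|an0]; first by rewrite gt0_muley.
by move=> [] /(canRL (divfK an0)); rewrite mul1r => ->.
Qed.

End condition_number.

(** * The infimum is 1, attained exactly by the solutions of positive level *)

Theorem theorem3 (R : realType) (n k N : nat)
    (n_gt0 : (0 < n)%N) (k_gt0 : (0 < k)%N) (N_gt0 : (0 < N)%N)
    (Omega : set 'rV[R]_n)
    (Omega_open : open Omega) (Omega_bounded : bounded_set Omega)
    (Omega_neq0 : Omega !=set0)
    (p : R) (p_ge1 : 1 <= p)
    (H : 'rV[R]_n * jet R N n k -> R)
    (H_cont : {within Omega `*` sym_jet (k := k), continuous H})
    (phi : 'rV[R]_n -> 'rV[R]_N) (phi_W : Wkinfty Omega k phi)
    (solvable : exists2 Lstar : R, 0 < Lstar &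
       forall L : R, Lstar <= L ->
         exists u : 'rV[R]_n -> 'rV[R]_N, dirichlet_solution Omega H phi L u)
    (uinfty : 'rV[R]_n -> 'rV[R]_N)
    (uinfty_W : Wkinfty_bc Omega k phi uinfty) :
  is_minimiser Omega H p phi uinfty <->
  exists2 L : R, 0 < L & dirichlet_solution Omega H phi L uinfty.
Proof.
have mO : measurable Omega by exact: measurable_open_rV.
have O_gt0 := lebesgue_rV_open_gt0 _ Omega_open Omega_neq0.
have O_fin := lebesgue_rV_bounded _ mO Omega_bounded.
have p_gt0 : 0 < p by exact: lt_le_trans p_ge1.
(* Symmetry and measurability of the chosen derivatives are among the clauses of
   [weak_derivative]. *)
have mH u : Wkinfty_bc Omega k phi u ->
    measurable_fun Omega (fun x => H (x, jet_of Omega k u x)).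
  move=> uW; have uD := Wkinfty_bc_weakD _ _ _ mO phi_W uW.
  apply: measurable_fun_jet_comp => // [x Ox j|j i].
    by have [+ _ _ _] := uD j (ltn_ord j); apply.
  by have [_ _ /(_ i)[]] := uD j (ltn_ord j).
have sol_adm L u : 0 < L -> dirichlet_solution Omega H phi L u ->
    condition_number Omega H p u = 1%E /\ energy Omega H 1%E u != 0%E.
  move=> L0 [uW uL]; split.
    exact: (condition_number_cst _ _ _ _ mO O_gt0 O_fin p_gt0 (mH u uW) L L0 uL).
  have mHu := mH u uW; rewrite /energy.
  rewrite (avg_norm_cst _ _ _ mO O_gt0 O_fin ltr01 mHu L (ltW L0) uL).
  by rewrite eqe gt_eqF.
have inf1 : ereal_inf [set condition_number Omega H p v | v in
    Wkinfty_bc Omega k phi `&` [set v | energy Omega H 1%E v != 0%E]] = 1%E.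
  (* A solution at the level [Lstar] is admissible and attains the lower bound 1. *)
  have [L L0 /(_ L (lexx L))[u uL]] := solvable.
  have [Cu Eu] := sol_adm L u L0 uL.
  apply/eqP; rewrite eq_le; apply/andP; split.
    by apply: ereal_inf_lbound; exists u => //; split; [case: uL | exact: Eu].
  apply: le_ereal_inf_tmp => _ [v [vW Ev] <-].
  exact: (condition_number_ge1 _ _ _ _ mO O_gt0 O_fin p_gt0 (mH v vW) Ev).
(* Minimality now says that the condition number is 1, and the equality case provides the level
   [L]. *)
rewrite /is_minimiser inf1; split=> [[Eu Cu]|[L L0 uL]]; last first.
  by have [] := sol_adm L uinfty L0 uL.
have [L L0 uL] := condition_number_eq1 _ _ _ _ mO O_gt0 O_fin p_gt0
  (mH _ uinfty_W) Eu Cu.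
by exists L.
Qed.
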